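(* Let $\mathcal{E}_+\in\Gamma(\mathcal{O}_{Ell_T(\mathcal{X}_+)})$ and let $T_z$ be the $q$-difference operator $T_z:z\to qz$, i.e. $(T_zf)(z)=f(qz)$. Then the elliptic central charge $Z^K(\mathcal{E}_+,V_+^\vee)$ satisfies the quantum $q$-difference equation $$\left[\prod_{i\le N_+}\prod_{k=1}^{D_i}\left(1-q^{k-q_i/2-D_i}a_iT_z^{D_i}\right)-z\prod_{i>N_+}\prod_{k=0}^{-D_i-1}\left(1-q^{k+q_i/2}a_i^{-1}T_z^{-D_i}\right)\right]Z^K(\mathcal{E}_+,V_+^\vee)=0 .$$
   Context: **Basic notation.** $E=\mathbb{C}^*/q^{\mathbb{Z}}$, $\phi(x)=\prod_{n\ge0}(1-q^nx)$, $\theta(x)=\phi(x)\phi(q/x)$, $\{x\}=x-\lfloor x\rfloor$. $\Lambda^*$ is the multiplicative class with $\Lambda^*(\sum_j\pm x_j)=\prod_j(1-x_j)^{\pm1}$. **GLSM data.** The data is $(V,G,\mathbb{C}^*_R,W,\omega)$ with $G\simeq\mathbb{C}^*$ with coordinate $s$, $W:V\to\mathbb{C}$ a $G$-invariant superpotential, weighted homogeneous for an action of $\mathbb{C}^*_R$ on $V$ commuting with $G$, and $\omega$ a character of $G$. $D_1,\dots,D_{N_+}>0>D_{N_++1},\dots,D_N$ are integers, $0<N_+<N$. $T$ is the maximal torus of $GL(V)$ with coordinates $a_1,\dots,a_N$ (roots $a_i^{1/D_i}$ are coordinates on a finite cover of $T$). $\Gamma\subset GL(V)$ is generated by $G$ and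 $\mathbb{C}^*_R$, $\mathbb{C}^*_w=\Gamma/G$, and $V=\sum_i a_is^{D_i}w^{q_i/2}$, which defines the R-charges $q_i$. $V_+$ is the sum of the summands with $i\le N_+$. Put $U_i=a_i^{-1}s^{-D_i}$, $d_i(\beta)=D_i\beta-q_i/2$. $\mathcal{X}=\mathcal{X}_+=[V/\!/_1G]$ (so $\omega>0$). **Inertia stack.** $\mathrm{Box}=\bigcup_{i\le N_+}\mu_{D_i}\subset G$; for $v\in\mathrm{Box}$ let $g(v)\in G$ be the corresponding element. $\mathcal{I}\mathcal{X}=\bigsqcup_{v\in\mathrm{Box}}\mathcal{X}_v$, $\mathcal{X}_v=[(V^{ss})^{g(v)}/G]$, $\iota_v:\mathcal{X}_v\to\mathcal{X}$. For a line bundle $L$, $\mathrm{age}_v(L)\in[0,1)$ is defined by $g(v)\cdot L=e^{2\pi\sqrt{-1}\,\mathrm{age}_v(L)}L$. For $\mathcal{F}\in K_T(\mathcal{I}\mathcal{X})$ with components $\mathcal{F}_v$, $\chi(\mathcal{F}):=\sum_v\chi(\mathcal{X}_v,\mathcal{F}_v)$, given explicitly by $$\chi(\mathcal{F})=\sum_{v\in\mathrm{Box}}\ \sum_{i\le N_+,\,g(v)^{D_i}=1}\ \sum_{\zeta\in\mu_{D_i}}\frac{\mathcal{F}_v}{\prod_{j\ne i,\,j\le N_+,\,g(v)^{D_j}=1}(1-a_j^{-1}s^{-D_j})}\bigg|_{s=\zeta a_i^{-1/D_i}} .$$ **Quasimap spaces.** $\mathbb{P}[a:1]=\{(x,y)\ne0\}/(x,y)\sim(\lambda^ax,\lambda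 y)$, $[\infty]=[1:0]$, $[0]=[0:1]$, with $\mathbb{C}^*_q$-action $(x,y)\mapsto(qx,y)$. $\mathcal{O}(n/a):=\mathcal{O}_{\mathbb{P}[a:1]}((n\bmod a)[\infty]+\lfloor n/a\rfloor[0])$, also viewed on the coarse space $\mathbb{P}^1$; $\chi_{\mathbb{C}^*_q}(\mathcal{O}(x))=\frac{q^{-\{x\}}}{1-q^{-1}}+\frac{q^{-x}}{1-q}$. For $\beta\in H_2(BG)_{\mathbb{Q}}\simeq\mathbb{Q}$ let $P_\beta$ be the principal $\Gamma$-bundle of degree $(\beta,1)$ on $\mathbb{P}[a:1]$, and $V_\beta=H^0(P_\beta\times_\Gamma V)=\sum_iH^0(\mathbb{P}^1,\mathcal{O}(d_i(\beta)))$, $W_\beta=H^1(P_\beta\times_\Gamma V)=\sum_iH^1(\mathbb{P}^1,\mathcal{O}(d_i(\beta)))$, the $i$-th summand having weight $a_is^{D_i}$. Put $\mathcal{X}_\beta=[V_\beta/\!/_\omega G]$, $\mathrm{Ob}_\beta=[V_\beta^{\omega-ss}\oplus W_\beta/G]$, and let $\mathcal{X}_\beta^\circ\subset\mathcal{X}_\beta$ be the quasimaps with value at $[\infty]$ in $V^{\omega-ss}$. Let $v(\beta)$ correspond to $g(\beta)=e^{2\pi\sqrt{-1}\beta}$; evaluation at $[\infty]$ is a map $ev_\infty:\mathcal{X}^\circ_\beta\to\mathcal{X}_{v(\beta)}$. $\mathcal{F}_\beta=[Z_\beta/\!/_\omega G]$ with $Z_\beta=\bigcap_{d_i(\beta)\notin\mathbb{Z}_{\ge0}}\{x_i=0\}\subset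 V$; $ev_\infty$ identifies $(\mathcal{X}_\beta^\circ)^{\mathbb{C}^*_q}$ with $\mathcal{F}_\beta\subset\mathcal{X}_{v(\beta)}$, and this inclusion is $ev_\infty^\beta$. $N_{vir}=\mathrm{Def}_m-\mathrm{Ob}_m$, where $\mathrm{Def}_m,\mathrm{Ob}_m$ are the parts of nonzero $\mathbb{C}^*_q$-weight of $T_{\mathcal{X}_\beta^\circ}|_{\mathcal{F}_\beta}$ and $\mathrm{Ob}_\beta|_{\mathcal{F}_\beta}$. **Level $R$ I-function.** Let $R=\sum R_{\bar l,m,n}a^{\bar l}s^mw^n\in K_T([V/\Gamma])$, $\sigma_R(\beta)=\sum R_{\bar l,m,n}\lfloor m\beta-n\rfloor$; $\pi_{\mathcal{C}}$ is the universal curve over $\mathcal{X}_\beta$ and $f_{\mathcal{C}}$ its universal map to $[V/\Gamma]$. With $z$ the Kähler variable (coordinate on the elliptic curve $E_G^\vee$ dual to $E_G=G/q^{\mathrm{cochar}(G)}$), $$I^K_R=\sum_{\beta\in\mathrm{Eff}}(-1)^{\sigma_R(\beta)}\frac{\theta(z^{-1})}{\theta(q^{-\{\beta\}}s^{-1}z^{-1})}z^{\lfloor\beta\rfloor}(ev^\beta_\infty)_*\left(\frac{\mathcal{O}_{\mathcal{F}_\beta}\otimes\det\big(\pi_{\mathcal{C},*}f_{\mathcal{C}}^*R\big)}{\Lambda^*N_{vir}^\vee}\right)\cdot\mathcal{O}_{\mathcal{X}_{v(\beta)}},\qquad \mathrm{Eff}=\bigcup_{i\le N_+}\frac1{D_i}\mathbb{Z}_{\ge0}.$$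 Here $R=V_+^\vee=\sum_{i\le N_+}a_i^{-1}s^{-D_i}$. The level $V_+^\vee$ K-theoretic Gamma class is $$\hat\Gamma_{K,V_+^\vee}=\sum_{v\in\mathrm{Box}}\frac{\prod_{i,\ \mathrm{age}_v(U_i)=0}(1-\iota_v^*a_is^{D_i})}{\prod_{i\le N}\phi(\iota_v^*a_i^{-1}s^{-D_i}q^{-\mathrm{age}_v(U_i)})}\cdot\mathcal{O}_{\mathcal{X}_v},$$ and $\mathcal{H}^K_{V_+^\vee}=I^K_{V_+^\vee}\cdot\hat\Gamma_{K,V_+^\vee}$. **Elliptic cohomology and central charge.** $E_T=T/q^{\mathrm{cochar}(T)}$ and $Ell_T(\mathcal{X}_+)=\{\prod_{i\le N_+}\theta(a_i^{-1}s^{-D_i})=0\}\subset E_T\times E_G$. Elliptic branes are sections of line bundles on $Ell_T(\mathcal{X}_+)$ together with a fixed quasiperiodic function representing them; $\mathcal{E}_+$ does not depend on $z$. $\mathrm{ch}_{K\to E}:\mathrm{Spec}\,K_T(\mathcal{X})\to Ell_T(\mathcal{X})$ is reduction modulo $q^{\mathrm{cochar}}$; pullback by it views a section as its quasiperiodic function. The orbifold elliptic Chern character is $$\mathrm{ch}^{E\to K}_{\mathrm{orb}}(\mathcal{E})=\sum_{v\in\mathrm{Box}}\big(q^{-\log(g(v))/2\pi\sqrt{-1}}\big)^*(\mathrm{ch}_{K\to E})^*(\mathcal{E}|_{\mathcal{X}_v})\cdot\mathcal{O}_{\mathcal{X}_v},\qquad \tfrac{\log g(v)}{2\pi\sqrt{-1}}\in[0,1),$$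 with the convention that, for example, for $[\mathbb{C}^3/\mu_3]$ and $\mathcal{E}=\theta(x)$ the components are $\theta(x),\theta(q^{1/3}x),\theta(q^{2/3}x)$. The elliptic central charge is $$Z^K(\mathcal{E},R):=\chi\big(\mathcal{H}^K_R\otimes\mathrm{ch}^{E\to K}_{\mathrm{orb}}(\mathcal{E})\big).$$
   Formalization: In the I-function, N_vir^∨ has weights U_i q^e with e the exponents in χ(O(x)); det(π_*f^*R) is read as det((π_*f^*V_+)^∨) with V_+ carrying w^{q_i/2}; Eff also includes β with d_i(β)∈Z_{≥0} for some i≤N_+. As literally written the equation fails. *)

(* Defs.v *)
From HB Require Import structures.
From mathcomp Require Import all_boot all_order all_algebra.
From mathcomp Require Import all_classical all_reals all_analysis.
From mathcomp Require Import complex.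
From mathcomp Require mpoly.
Import Order.TTheory GRing.Theory Num.Theory numFieldNormedType.Exports.

Set Implicit Arguments.
Unset Strict Implicit.
Unset Printing Implicit Defensive.

Local Open Scope ring_scope.
Local Open Scope classical_set_scope.
Local Open Scope complex_scope.

(* The usual topology of the complex numbers, so that [lim] and
   [differentiable] (= complex differentiable) make sense over R[i]. *)
HB.instance Definition _ (R : realType) := NormedModule.copy R[i] R[i]^o.

(* GLSM data for G = C^*.  Indices i : 'I_N with N = dimV.+1 are 0-based, so
   "i <= N_+" is [i < npos].  [rch i] is q_i/2, an integer because it is the
   exponent of w in the weight a_i s^{D_i} w^{q_i/2} of the torus Gamma. *)
Record glsm (R : realType) := Glsm {
  dimV : nat;
  npos : nat;
  wt : 'I_dimV.+1 -> int;
  rch : 'I_dimV.+1 -> int;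
  potential : mpoly.mpoly dimV.+1 R[i];
  omega : int;
  npos_gt0 : (0 < npos)%N;
  npos_lt : (npos < dimV.+1)%N;
  wt_gt0 : forall i : 'I_dimV.+1, (i < npos)%N -> 0 < wt i;
  wt_lt0 : forall i : 'I_dimV.+1, (npos <= i)%N -> wt i < 0;
  potential_G_invariant : forall (s : R[i]) (x : 'I_dimV.+1 -> R[i]), s != 0 ->
    mpoly.meval (fun i => s ^ wt i * x i) potential = mpoly.meval x potential;
  potential_homogeneous : exists k : int,
    forall (w : R[i]) (x : 'I_dimV.+1 -> R[i]), w != 0 ->
    mpoly.meval (fun i => w ^ rch i * x i) potential =
      w ^ k * mpoly.meval x potential;
  omega_gt0 : 0 < omega }.

(* A term c a^l s^m w^n of a class in K_T([V/Gamma]). *)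
Record kterm (I : Type) := KTerm {
  kmult : int; kexp_a : I -> int; kexp_s : int; kexp_w : int }.

Section Functions.
Variable R : realType.
Local Notation C := R[i].

Definition cexp (z : C) : C :=
  (expR (complex.Re z))%:C
    * (cos (complex.Im z) +i* sin (complex.Im z)).

(* e(x) = exp(2 pi sqrt(-1) x) *)
Definition cis (x : rat) : C := cexp ((0 +i* (2 * pi)) * ratr x).

(* q^x, for q = exp(2 pi sqrt(-1) tau); fixing tau fixes the rational powers
   of q.  |q| < 1 iff 0 < Im tau. *)
Definition qpow (tau : C) (x : rat) : C :=
  cexp ((0 +i* (2 * pi)) * tau * ratr x).

Definition phi (tau x : C) : C :=
  limn (fun n : nat => \prod_(k < n) (1 - qpow tau 1 ^+ k * x)).

Definition theta (tau x : C) : C := phi tau x * phi tau (qpow tau 1 / x).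

Definition fracp (x : rat) : rat := x - (Num.floor x)%:~R.

(* \sum_(n in Z) f n; only used with f n = 0 for n << 0. *)
Definition zsum (f : int -> C) : C :=
  limn (fun M : nat => \sum_(k < M.*2.+1) f (k%:Z - M%:Z)).

(* The q-exponents of H^0(P^1, O(x)) and H^1(P^1, O(x)), normalized so that
   H^0 - H^1 = q^{-{x}}/(1 - q^{-1}) + q^{-x}/(1 - q).
   Here f(x, y) |-> f(q x, y) acts on sections by pullback, so that the pole
   x^{-k} at [0] has weight q^{-k}; as representations with (g f)(p) =
   f(g^{-1} p) these spaces have the opposite weights.  Consequently the
   weights of (a_i s^{D_i} (x) H^*(O(x)))^vee are the U_i q^e with
   U_i = a_i^{-1} s^{-D_i} and e in [h0 x], [h1 x]. *)
Definition h0 (x : rat) : seq rat :=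
  [seq - fracp x - k%:R | k <- iota 0 (absz (Num.max 0 (Num.floor x + 1)))].

Definition h1 (x : rat) : seq rat :=
  [seq k%:R - fracp x | k <- iota 1 (absz (Num.max 0 (- Num.floor x - 1)))].

End Functions.

Section CentralCharge.
Variables (R : realType) (X : glsm R).
Local Notation C := R[i].
Local Notation I := 'I_(dimV X).+1.
Variables (tau : C) (a : 'rV[C]_(dimV X).+1).
Local Notation q := (qpow tau).

Definition U (i : I) (s : C) : C := (a ord0 i)^-1 * s ^ (- wt i).

Definition deg (i : I) (beta : rat) : rat :=
  (wt i)%:~R * beta - (rch i)%:~R.

(* The degrees beta with D_i beta in Z_{>=0} for some i <= N_+.  The second
   alternative (d_i(beta) in Z_{>=0}, i.e. x_i <> 0 occurs in Z_beta) follows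
   from the first if q_i >= 0 for i <= N_+; it only matters for negative
   R-charges on V_+, where it adds the remaining beta with F_beta nonempty. *)
Definition eff (beta : rat) : bool :=
  [exists i : I, (i < npos X)%N &&
     (((wt i)%:~R * beta \is a Num.nat) || (deg i beta \is a Num.nat))].

(* v in Box is encoded by b = log(g(v)) / (2 pi sqrt(-1)) in [0, 1), so
   g(v) = e(b) and g(v)^{D_j} = 1 iff D_j b is an integer. *)
Definition fixes (b : rat) (j : I) : bool := (wt j)%:~R * b \is a Num.int.

Definition age (b : rat) (m : int) : rat := fracp (m%:~R * b).

(* A class in K_T(IX) (or its localization) is represented by its components
   F b s, functions of the coordinate s of G. *)

(* The class of O_{F_beta} in K_T(X_v), v = v(beta): Koszul resolution of the
   coordinates of X_v vanishing on Z_beta. *)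
Definition structure_sheaf (beta : rat) (s : C) : C :=
  \prod_(j : I | fixes (fracp beta) j && (deg j beta \isn't a Num.nat))
     (1 - U j s).

(* Lambda^* of Def_m^vee and Ob_m^vee; the C^*_q-fixed part (e = 0) is
   removed.  T_{X_beta} = V_beta - Lie(G), and Lie(G) has no moving part. *)
Definition Lambda_def (beta : rat) (s : C) : C :=
  \prod_(j : I) \prod_(e <- h0 (deg j beta) | e != 0) (1 - U j s * q e).

Definition Lambda_ob (beta : rat) (s : C) : C :=
  \prod_(j : I) \prod_(e <- h1 (deg j beta) | e != 0) (1 - U j s * q e).

Definition Lambda_Nvir_dual (beta : rat) (s : C) : C :=
  Lambda_def beta s / Lambda_ob beta s.

Definition kclass := seq (kterm I).

(* V_+^vee, for V_+ = \sum_(i <= N_+) a_i s^{D_i} w^{q_i/2} *)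
Definition Vplus_dual : kclass :=
  [seq KTerm 1 (fun j => - (j == i)%:Z) (- wt i) (- rch i)
     | i : I <- enum I & (i < npos X)%N].

Definition sigma (Q : kclass) (beta : rat) : int :=
  \sum_(t <- Q)
     kmult t * Num.floor ((kexp_s t)%:~R * beta - (kexp_w t)%:~R).

(* The level line bundle.  The pushforward of f^* Q is dualized on the target:
   it is (pi_* f^* Q^vee)^vee, so for Q = V_+^vee it is (pi_* f^* V_+)^vee,
   the virtual bundle with weights U_i q^e, e in h0(d_i) - h1(d_i), whose
   moving part is the V_+-part of N_vir^vee.  (pi_* f^* V_+^vee without this convention
   differs from it by Serre duality and an inversion of the determinant.) *)
Definition level_det (Q : kclass) (beta : rat) (s : C) : C :=
  \prod_(t <- Q)
    (let L := (\prod_(j : I) a ord0 j ^ kexp_a t j) * s ^ kexp_s t in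
     let x := (kexp_w t)%:~R - (kexp_s t)%:~R * beta in
     (\prod_(e <- h0 x) (L * q e)) / (\prod_(e <- h1 x) (L * q e)))
    ^ kmult t.

Definition I_term (Q : kclass) (z : C) (beta : rat) (s : C) : C :=
  (-1) ^ sigma Q beta
  * (theta tau z^-1 / theta tau (q (- fracp beta) * s^-1 * z^-1))
  * z ^ Num.floor beta
  * (structure_sheaf beta s
       * (level_det Q beta s / Lambda_Nvir_dual beta s)).

(* The component of I^K_Q on X_v collects the beta in Eff with {beta} = b. *)
Definition I_K (Q : kclass) (z : C) (b : rat) (s : C) : C :=
  zsum (fun n => if eff (b + n%:~R) then I_term Q z (b + n%:~R) s else 0).

(* Gamma class of level V_+^vee.  When age(U_i) = 0 its i-th factor is
   (1 - U_i^{-1}) / phi(U_i); as phi(x) = (1 - x) phi(q x), this is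
   - U_i^{-1} / phi(q U_i), which unlike the quotient can be evaluated at
   the fixed points where U_i = 1. *)
Definition Gamma_K (b : rat) (s : C) : C :=
  \prod_(i : I)
    (if age b (- wt i) == 0 then - (U i s)^-1 / phi tau (q 1 * U i s)
     else (phi tau (U i s * q (- age b (- wt i))))^-1).

Definition H_K (z : C) (b : rat) (s : C) : C :=
  I_K Vplus_dual z b s * Gamma_K b s.

(* Component of the orbifold elliptic Chern character: pullback along
   translation of E_G by q^{- log g(v) / (2 pi sqrt(-1))}. *)
Definition ch_orb (E : 'rV[C]_(dimV X).+1 * C -> C) (b : rat) (s : C) : C :=
  E (a, q (- b) * s).

(* [lcm_wt] is a common multiple of the D_i, i <= N_+; Box is enumerated as
   the b = m / lcm_wt in [0, 1) with D_i b integral for some i <= N_+. *)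
Definition lcm_wt : nat := \big[lcmn/1%N]_(i : I | (i < npos X)%N) `|wt i|%N.

Definition box (m : 'I_lcm_wt) : rat := m%:R / lcm_wt%:R.

Definition in_box (b : rat) : bool :=
  [exists i : I, (i < npos X)%N && fixes b i].

(* Fixed points s = zeta a_i^{-1/D_i}, zeta = e(k / D_i); [r i] is the chosen
   root a_i^{1/D_i}. *)
Definition fixed_pt (r : I -> C) (i : I) (k : nat) : C :=
  cis R (k%:R / (wt i)%:~R) * (r i)^-1.

Definition chi (r : I -> C) (F : rat -> C -> C) : C :=
  \sum_(m < lcm_wt | in_box (box m))
    \sum_(i : I | (i < npos X)%N && fixes (box m) i)
      \sum_(k < `|wt i|%N)
        F (box m) (fixed_pt r i k)
        / \prod_(j : I | [&& j != i, (j < npos X)%N & fixes (box m) j])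
            (1 - U j (fixed_pt r i k)).

Definition Z_K (r : I -> C) (E : 'rV[C]_(dimV X).+1 * C -> C) (z : C) : C :=
  chi r (fun b s => H_K z b s * ch_orb E b s).

(* The torus parameter a is not on a pole of a summand of the I-function:
   Lambda^* Def_m^vee is invertible at the fixed points of F_beta. *)
Definition generic (r : I -> C) : Prop :=
  forall (beta : rat) (i : I) (k : nat),
    eff beta -> (i < npos X)%N -> deg i beta \is a Num.nat ->
    (k < `|wt i|)%N -> Lambda_def beta (fixed_pt r i k) != 0.

Definition opT (n : int) (f : C -> C) : C -> C :=
  fun z => f (q n%:~R * z).

(* 1 - c T_z^n *)
Definition one_sub (c : C) (n : int) (f : C -> C) : C -> C :=
  fun z => f z - c * opT n f z.

Definition op_plus : (C -> C) -> C -> C :=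
  \big[(fun A B => A \o B)/idfun]_(i : I | (i < npos X)%N)
    \big[(fun A B => A \o B)/idfun]_(1 <= k < `|wt i|.+1)
      one_sub (q (k%:R - (rch i)%:~R - (wt i)%:~R) * a ord0 i) (wt i).

Definition op_minus : (C -> C) -> C -> C :=
  \big[(fun A B => A \o B)/idfun]_(i : I | (npos X <= i)%N)
    \big[(fun A B => A \o B)/idfun]_(0 <= k < `|wt i|)
      one_sub (q (k%:R + (rch i)%:~R) * (a ord0 i)^-1) (- wt i).

End CentralCharge.

Section EllipticBranes.
Variables (R : realType) (X : glsm R) (tau : R[i]).
Local Notation C := R[i].
Local Notation TG := ('rV[C]_(dimV X).+1 * C)%type.

(* Preimage of Ell_T(X_+) in T x G. *)
Definition Ell : set TG :=
  [set p : TG | [/\ forall i, p.1 ord0 i != 0, p.2 != 0 &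
    \prod_(i : 'I_(dimV X).+1 | (i < npos X)%N) theta tau (U p.1 i p.2) = 0]].

Definition translate (l : 'I_(dimV X).+1 -> int) (m : int) (p : TG) : TG :=
  (\row_i (qpow tau (l i)%:~R * p.1 ord0 i), qpow tau m%:~R * p.2).

(* Global sections of O_{Ell_T(X_+)}: functions on the preimage of Ell,
   invariant under q^{cochar(T)} x q^{cochar(G)}, which are locally
   restrictions of holomorphic functions. *)
Definition section_Ell (E : TG -> C) : Prop :=
  (forall l m p, Ell p -> E (translate l m p) = E p) /\
  (forall p, Ell p -> exists F : TG -> C,
     (\forall p' \near p, differentiable F p') /\
     (\forall p' \near p, Ell p' -> E p' = F p')).

End EllipticBranes.

(* Main.v *)
Require Import Defs.
From mathcomp Require Import all_boot all_order all_algebra.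
From mathcomp Require Import all_classical all_reals all_analysis.
From mathcomp Require Import complex ring lra zify.
Import Order.TTheory GRing.Theory Num.Theory numFieldNormedType.Exports.

(* Since theta is quasi-periodic, T_z multiplies the summand of degree beta of
   the I-function, restricted to a fixed point, by q^beta s.  The two operators
   are therefore polynomials evaluated at q^beta s, and the equation becomes a
   first-order recurrence for the coefficients of the I-function.  It is checked
   one coordinate of V at a time: lowering d = d_i(beta) by 1 multiplies the
   Koszul and Euler factors by 1 - U q^(-d), and the level structure turns this
   into 1 - U^(-1) q^d for the positive weights.  At a fixed point on the i-th
   axis U_i = 1, so that the coefficient vanishes unless d_i(beta) is a natural
   number; this supplies the boundary terms.  The ratio of successive summands
   tends to z, hence the series converge for |z| < 1 and the partial sums
   telescope. *)

Set Implicit Arguments.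
Unset Strict Implicit.
Unset Printing Implicit Defensive.
Local Open Scope ring_scope.
Local Open Scope complex_scope.

(** * Convergence of complex sequences and series *)

Section ComplexSequences.
Variable R : realType.
Local Notation C := R[i].
Local Open Scope classical_set_scope.
Implicit Types (u t x : nat -> C) (l : C).

Lemma cvg_real_complex (v : nat -> R) (c : R) :
  v @ \oo --> c -> (fun n => (v n)%:C) @ \oo --> c%:C.
Proof.
move=> /cvgrPdist_lt vc; apply/cvgrPdist_lt => -[e e'].
(* A positive element of [R[i]] is real, so the radius has imaginary part 0. *)
rewrite ltcE /= => /andP[/eqP -> e0]; near=> n.
rewrite -rmorphB normc_def /= expr0n addr0 sqrtr_sqr ltcR.
by near: n; exact: vc.
Unshelve. all: by end_near. Qed.

Lemma cvg_complex u (a b : R) :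
  (fun n => complex.Re (u n)) @ \oo --> a ->
  (fun n => complex.Im (u n)) @ \oo --> b -> u @ \oo --> a +i* b.
Proof.
move=> ua ub.
have -> : a +i* b = a%:C + 'i * b%:C by rewrite [LHS]complexE.
have -> : u = fun n => (complex.Re (u n))%:C + 'i * (complex.Im (u n))%:C.
  by apply/funext => n; rewrite [LHS]complexE.
apply: cvgD; first exact: cvg_real_complex.
by apply: cvgM; [exact: cvg_cst|exact: cvg_real_complex].
Qed.

(** The modulus bounds the real and imaginary parts, so each gives an absolutely convergent real
    series. *)
Lemma geometric_bound_cvg_series u (K rho : R) :
  0 <= rho < 1 -> (forall n, `|u n| <= (K * rho ^+ n)%:C) ->
  cvgn (series u).
Proof.
move=> /andP[rho0 rho1] uK.
have geo : cvgn (series (geometric K rho)).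
  by apply: is_cvg_geometric_series; rewrite ger0_norm.
have K0 n : 0 <= K * rho ^+ n.
  by rewrite -lecR; exact: le_trans (normr_ge0 _) (uK n).
have part (g : C -> R) : (forall c : C, `|g c|%:C <= `|c|) ->
    cvgn (series (fun n => g (u n))).
  move=> gP; apply: normed_cvg; apply: series_le_cvg geo => //= n.
  by rewrite -lecR; exact: le_trans (gP _) (uK n).
have Reu : (fun n => complex.Re (series u n))
    = series (fun n => complex.Re (u n)).
  by apply/funext => n; rewrite /series /= raddf_sum.
have Imu : (fun n => complex.Im (series u n))
    = series (fun n => complex.Im (u n)).
  by apply/funext => n; rewrite /series /= raddf_sum.
have /cvg_ex[a aP] : cvgn (series (fun n => complex.Re (u n))).
  apply: part => -[c d] /=; rewrite normc_def /= lecR -sqrtr_sqr.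
  by rewrite ler_wsqrtr // lerDl sqr_ge0.
have /cvg_ex[b bP] : cvgn (series (fun n => complex.Im (u n))).
  apply: part => -[c d] /=; rewrite normc_def /= lecR -sqrtr_sqr.
  by rewrite ler_wsqrtr // lerDr sqr_ge0.
apply/cvg_ex; exists (a +i* b).
by apply: cvg_complex; rewrite ?Reu ?Imu.
Qed.

Lemma cvg_series_shift u N :
  cvgn (series (fun n => u (n + N)%N)) -> cvgn (series u).
Proof.
move=> /cvg_ex[l ul]; apply/cvg_ex; exists (series u N + l).
rewrite -(cvg_shiftn N) /=.
have -> : (fun n => series u (n + N)%N)
    = (fun n => series u N + series (fun k => u (k + N)%N) n).
  apply/funext => n; rewrite /series /= (@big_cat_nat _ _ _ N) ?leq_addl //=.
  by rewrite -{2}(add0n N) big_addn addnK.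
by apply: cvgD; [exact: cvg_cst|exact: ul].
Qed.

Lemma ratio_test t x l : x @ \oo --> l -> `|l| < 1 ->
  (\forall n \near \oo, t n.+1 = x n * t n) -> cvgn (series t).
Proof.
(* Norms take values in [R[i]]; [L] is the underlying real number, and [rho] is the midpoint of [L]
   and 1. *)
move=> xl l1 tx; pose L := complex.Re `|l|; pose rho := (1 + L) / 2.
have LE : `|l| = L%:C by rewrite /L normc_def.
have L0 : 0 <= L by rewrite -lecR -LE; exact: normr_ge0.
have L1 : L < 1 by rewrite -ltcR -LE; exact: l1.
have rho1 : 0 <= rho < 1 by rewrite /rho; apply/andP; split; lra.
have : \forall n \near \oo, `|x n| < rho%:C.
  have lrho : `|l| < rho%:C by rewrite LE ltcR /rho; lra.
  exact: (@cvgr_norm_lt _ _ _ _ _ _ _ xl _ lrho).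
move=> xrho; have [N _ NP] : \forall n \near \oo,
    `|x n| < rho%:C /\ t n.+1 = x n * t n.
  by near=> n; split; near: n.
apply: (@cvg_series_shift _ N).
apply: (@geometric_bound_cvg_series _ (complex.Re `|t N|) rho) => //.
elim=> [|n IH]; first by rewrite mulr1 normc_def.
have [/= x1 tE] := NP (n + N)%N (leq_addl _ _).
rewrite addSn tE normrM exprS mulrCA rmorphM.
by apply: ler_pM => //; exact: ltW.
Unshelve. all: by end_near. Qed.

Lemma cvg_horner (p : {poly C}) u l :
  u @ \oo --> l -> (fun n => p.[u n]) @ \oo --> p.[l].
Proof.
move=> ul; elim/poly_ind: p => [|p c IH].
  under eq_fun do rewrite horner0.
  by rewrite horner0; exact: cvg_cst.
under eq_fun do rewrite hornerMXaddC.
rewrite hornerMXaddC; apply: cvgD; last exact: cvg_cst.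
by apply: cvgM; [exact: IH|exact: ul].
Qed.

Lemma cvg_expC (c : C) : `|c| < 1 -> (fun n => c ^+ n) @ \oo --> (0 : C).
Proof.
move=> c1; pose L := complex.Re `|c|.
have LE : `|c| = L%:C by rewrite /L normc_def.
have L0 : 0 <= L by rewrite -lecR -LE; exact: normr_ge0.
have : (fun n => L ^+ n) @ \oo --> (0 : R).
  by apply: cvg_expr; rewrite ger0_norm // -ltcR -LE.
move=> /cvgrPdist_lt Lc; apply/cvgrPdist_lt => -[e e'].
rewrite ltcE /= => /andP[/eqP -> e0]; near=> n.
rewrite sub0r normrN normrX LE -rmorphXn ltcR.
rewrite -[ltLHS]ger0_norm ?exprn_ge0 // -normrN -sub0r.
by near: n; exact: Lc.
Unshelve. all: by end_near. Qed.

End ComplexSequences.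

(** * q-difference operators on two-sided series *)

Section DifferenceOperators.
Variables (R : realType) (tau Q : R[i]).
Local Notation C := R[i].
Local Open Scope classical_set_scope.
Hypotheses (Q0 : Q != 0) (Q1 : `|Q| < 1).
Hypothesis qpow_int : forall n : int, qpow tau n%:~R = Q ^ n.

(** A domain stable under z -> Q z, hence suited to operators with only non-negative powers of
    T_z. *)
Definition punctured_disc (z : C) : Prop := z != 0 /\ `|z| < 1.

Lemma punctured_discM m z :
  punctured_disc z -> punctured_disc (Q ^+ m * z).
Proof.
move=> [z0 z1]; split; first by rewrite mulf_neq0 // expf_neq0.
rewrite normrM normrX -[1]mul1r; apply: le_lt_trans (_ : 1 * `|z| < _).
  by rewrite ler_wpM2r // exprn_ile1 // ltW.
by rewrite !mul1r.
Qed.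

Definition partial_sum (F : int -> C) (M : nat) : C :=
  \sum_(k < M.*2.+1) F (k%:Z - M%:Z).

(** Convergence is built in, because [lim] also assigns a value to divergent sequences. [Theta] will
    be the theta quotient common to all terms. *)
Definition represents (Theta : C -> C) (A : int -> C) (f : C -> C) : Prop :=
  forall z, punctured_disc z ->
    partial_sum (fun n => A n * (Theta z * z ^ n)) @ \oo --> f z.

Definition quasi_periodic (kappa : C) (Theta : C -> C) : Prop :=
  forall z, z != 0 -> Theta (Q * z) = kappa * Theta z.

(* T_z multiplies Theta z * z ^ n by kappa * Q ^ n, so this says that op is the
   polynomial p in T_z. *)
Definition acts_by (op : (C -> C) -> C -> C) (p : {poly C}) : Prop :=
  forall kappa Theta A f, quasi_periodic kappa Theta ->
    represents Theta A f ->
    represents Theta (fun n => p.[kappa * Q ^ n] * A n) (op f).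

Lemma quasi_periodic_expr kappa Theta m z :
  quasi_periodic kappa Theta -> z != 0 ->
  Theta (Q ^+ m * z) = kappa ^+ m * Theta z.
Proof.
move=> qp z0; elim: m => [|m IH]; first by rewrite !mul1r.
rewrite exprS -mulrA qp ?IH ?exprS ?mulrA //.
by rewrite mulf_neq0 // expf_neq0.
Qed.

Lemma represents_ext Theta A B f :
  A =1 B -> represents Theta A f -> represents Theta B f.
Proof. by move=> /funext ->. Qed.

Lemma acts_by_id : acts_by idfun 1.
Proof.
move=> kappa Theta A f _; apply: represents_ext => n.
by rewrite hornerC mul1r.
Qed.

Lemma acts_by_comp op1 op2 p1 p2 :
  acts_by op1 p1 -> acts_by op2 p2 -> acts_by (op1 \o op2) (p1 * p2).
Proof.
move=> h1 h2 kappa Theta A f qp rf.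
apply: represents_ext (h1 _ _ _ _ qp (h2 _ _ _ _ qp rf)) => n.
by rewrite hornerM mulrA.
Qed.

Lemma partial_sumB c F G M :
  partial_sum (fun n => F n - c * G n) M
    = partial_sum F M - c * partial_sum G M.
Proof. by rewrite /partial_sum big_split /= mulr_sumr -sumrN. Qed.

(** By quasi-periodicity, the n-th term at [Q ^+ m * z] is the n-th term at [z] times
    [(kappa * Q ^ n) ^+ m], the value of the monomial. *)
Lemma acts_by_one_sub c (m : nat) :
  acts_by (one_sub tau c m) (1 - c *: 'X^m).
Proof.
move=> kappa Theta A f qp rf z zd.
have [z0 _] := zd.
have -> : partial_sum (fun n => (1 - c *: 'X^m).[kappa * Q ^ n] * A n
      * (Theta z * z ^ n))
    = (fun M => partial_sum (fun n => A n * (Theta z * z ^ n)) M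
      - c * partial_sum (fun n => A n * (Theta (Q ^+ m * z) * (Q ^+ m * z) ^ n)) M).
  apply/funext => M; rewrite -partial_sumB; apply: eq_bigr => k _.
  rewrite (quasi_periodic_expr _ qp z0) hornerD hornerN hornerZ hornerXn hornerC.
  rewrite exprMn exprzMl ?unitfE ?expf_neq0 //.
  have -> : (Q ^+ m) ^ (k%:Z - M%:Z) = (Q ^ (k%:Z - M%:Z)) ^+ m.
    by rewrite !exprnP !exprz_exp mulrC.
  ring.
rewrite /one_sub /opT qpow_int -exprnP.
apply: cvgB; first exact: rf.
apply: cvgM; first exact: cvg_cst.
exact/rf/punctured_discM.
Qed.

Definition linear_operator (op : (C -> C) -> C -> C) : Prop :=
  forall (c : C) f g, op (fun z => c * f z + g z) = (fun z => c * op f z + op g z).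

Lemma linear_operator_one_sub c n : linear_operator (one_sub tau c n).
Proof.
by move=> d f g; apply/funext => z; rewrite /one_sub /opT; ring.
Qed.

Lemma linear_operator_comp op1 op2 : linear_operator op1 ->
  linear_operator op2 -> linear_operator (op1 \o op2).
Proof. by move=> h1 h2 d f g; rewrite /= h2 h1. Qed.

(** With no terms below -N, the sum over [-(n+N), n+N] is the one-sided partial sum starting at -N
    with n + 2N + 1 terms. *)
Lemma zsum_cvg (F : int -> C) (N : nat) :
  (forall n : int, n < - N%:Z -> F n = 0) ->
  cvgn (series (fun k : nat => F (k%:Z - N%:Z))) ->
  partial_sum F @ \oo --> zsum F.
Proof.
move=> F0 cF; suff : cvgn (partial_sum F) by [].
have /cvg_ex[l lP] := cF; apply/cvg_ex; exists l.
rewrite -(cvg_shiftn N) /=.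
have -> : (fun n => partial_sum F (n + N)) =
   (fun n => series (fun k : nat => F (k%:Z - N%:Z)) (n + (N + N).+1)%N).
  apply/funext => n; rewrite /partial_sum /series /=.
  rewrite -(big_mkord xpredT (fun k => F (k%:Z - (n + N)%N%:Z))).
  rewrite (@big_cat_nat _ _ _ n) //=; last by lia.
  rewrite big_nat_cond big1 ?add0r => [|k /andP[/andP[_ kn] _]]; last first.
    by apply: F0; lia.
  rewrite -{1}(add0n n) big_addn.
  have -> : ((n + N).*2.+1 - n = n + (N + N).+1)%N by lia.
  by apply: eq_bigr => k _; congr F; lia.
by rewrite (cvg_shiftn (N + N).+1 (series _)).
Qed.

(** Consecutive symmetric sums differ by the terms at M+1 and -(M+1), and the latter is eventually
    0. This controls the upper boundary term of the telescoping sum. *)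
Lemma cvg_partial_sum_last (F : int -> C) (l : C) (N : nat) :
  (forall n : int, n < - N%:Z -> F n = 0) ->
  partial_sum F @ \oo --> l -> (fun M : nat => F M.+1%:Z) @ \oo --> (0 : C).
Proof.
move=> F0 Fl.
have Fl1 : (fun M => partial_sum F (M + 1)) @ \oo --> l.
  by rewrite (cvg_shiftn 1 (partial_sum F)).
have : (fun M => partial_sum F (M + 1) - partial_sum F M) @ \oo --> (0 : C).
  by rewrite -[X in _ --> X](subrr l); apply: cvgB; [exact: Fl1|exact: Fl].
apply: cvg_trans; apply: near_eq_cvg; near=> M.
rewrite /partial_sum addn1 doubleS big_ord_recr big_ord_recl /=.
rewrite F0 ?add0r; last first.
  have : (N <= M)%N by near: M; exact: nbhs_infty_ge.
  by lia.
under eq_bigr => k _.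
  have -> : (lift ord0 k)%:Z - M.+1%:Z = k%:Z - M%:Z by rewrite /lift /= /bump; lia.
  over.
rewrite addrAC subrr add0r; congr F; lia.
Unshelve. all: by end_near. Qed.

Lemma partial_sum_telescope (F : int -> C) M :
  partial_sum (fun n => F n - F (n + 1)) M = F (- M%:Z) - F M.+1%:Z.
Proof.
rewrite /partial_sum -(big_mkord xpredT (fun k => F (k%:Z - M%:Z) - F (k%:Z - M%:Z + 1))).
have := @telescope_sumr _ 0 M.*2.+1 (fun k : nat => - F (k%:Z - M%:Z)) isT.
rewrite opprK sub0r addrC (_ : M.*2.+1%:Z - M%:Z = M.+1%:Z); last by lia.
move=> <-; apply: eq_bigr => k _; rewrite opprK [RHS]addrC; congr (_ - F _).
by lia.
Qed.

Lemma zsum_represents (Theta : C -> C) (kappa : C) (A : int -> C) (N : nat)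
    (pp pm : {poly C}) :
  pp.[0] = 1 -> pm.[0] = 1 ->
  (forall n : int, n < - N%:Z -> A n = 0) ->
  (forall n : int, pp.[kappa * Q ^ (n + 1)] * A (n + 1) = pm.[kappa * Q ^ n] * A n) ->
  represents Theta A (fun z => zsum (fun n => A n * (Theta z * z ^ n))).
Proof.
move=> pp0 pm0 A0 rec z [z0 z1].
apply: (@zsum_cvg _ N) => [n nN|]; first by rewrite A0 // mul0r.
(* [y k] is the argument of the polynomials at index k - N. It tends to 0, so both polynomials tend
   to their constant term 1. *)
pose y (k : nat) : C := kappa * Q ^ (k%:Z - N%:Z).
have y0 : y @ \oo --> (0 : C).
  have -> : y = fun k => (kappa * Q ^ (- N%:Z)) * Q ^+ k.
    apply/funext => k; rewrite /y expfzDr // -exprnP; ring.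
  rewrite -(mulr0 (kappa * Q ^ (- N%:Z))).
  by apply: cvgM; [exact: cvg_cst|exact: cvg_expC Q1].
have y1 : (fun k => y k.+1) @ \oo --> (0 : C).
  have : (fun k => y (k + 1)%N) @ \oo --> (0 : C) by rewrite (cvg_shiftn 1 y).
  by under eq_fun do rewrite addn1.
have ppc : (fun k => pp.[y k.+1]) @ \oo --> (1 : C).
  by rewrite -pp0; exact: (@cvg_horner _ pp _ _ y1).
have pmc : (fun k => pm.[y k]) @ \oo --> (1 : C).
  by rewrite -pm0; exact: (@cvg_horner _ pm _ _ y0).
apply: (@ratio_test _ _ (fun k => z * (pm.[y k] * (pp.[y k.+1])^-1)) z _ z1).
  rewrite -[X in _ --> X]mulr1; apply: cvgM; first exact: cvg_cst.
  rewrite -[X in _ --> X](mulr1 1); apply: cvgM; first exact: pmc.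
  by rewrite -invr1; apply: cvgV; [exact: oner_neq0|exact: ppc].
near=> k.
(* Being close to 1, this value is eventually invertible, and the recurrence can be solved for the
   next coefficient. *)
have pp_neq0 : pp.[y k.+1] != 0.
  rewrite -normr_gt0; near: k.
  by apply: (@cvgr_norm_gt _ _ _ _ _ _ _ ppc); rewrite normr1 ltr01.
have kE : k.+1%:Z - N%:Z = k%:Z - N%:Z + 1 by lia.
have := rec (k%:Z - N%:Z); rewrite -kE -/(y k) -/(y k.+1) => recE.
have -> : A (k.+1%:Z - N%:Z) = pm.[y k] / pp.[y k.+1] * A (k%:Z - N%:Z).
  by apply: (mulfI pp_neq0); rewrite recE; field.
have -> : z ^ (k.+1%:Z - N%:Z) = z * z ^ (k%:Z - N%:Z).
  by rewrite kE expfzDr // expr1z mulrC.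
ring.
Unshelve. all: by end_near. Qed.

Lemma qdifference_equation (opp opm : (C -> C) -> C -> C) (pp pm : {poly C})
    (Theta : C -> C) (kappa : C) (A : int -> C) (N : nat) z :
  acts_by opp pp -> acts_by opm pm -> pp.[0] = 1 -> pm.[0] = 1 ->
  quasi_periodic kappa Theta ->
  (forall n : int, n < - N%:Z -> A n = 0) ->
  (forall n : int, pp.[kappa * Q ^ (n + 1)] * A (n + 1) = pm.[kappa * Q ^ n] * A n) ->
  punctured_disc z ->
  let f := fun z => zsum (fun n => A n * (Theta z * z ^ n)) in
  opp f z - z * opm f z = 0.
Proof.
move=> opP omP pp0 pm0 qp A0 rec zd f; have [z0 _] := zd.
have fP : represents Theta A f by exact: zsum_represents pp0 pm0 A0 rec.
pose F n := pp.[kappa * Q ^ n] * A n * (Theta z * z ^ n).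
have F0 (n : int) : n < - N%:Z -> F n = 0.
  by move=> nN; rewrite /F A0 // mulr0 mul0r.
have pc : partial_sum F @ \oo --> opp f z by exact: opP qp fP _ zd.
have mc := omP _ _ _ _ qp fP _ zd.
(* By the recurrence, [z] times the n-th term of the second series is [F (n + 1)], so the difference
   of the two series telescopes. *)
have : (fun M => F (- M%:Z) - F M.+1%:Z) @ \oo --> opp f z - z * opm f z.
  have -> : (fun M => F (- M%:Z) - F M.+1%:Z) = (fun M => partial_sum F M
      - z * partial_sum (fun n => pm.[kappa * Q ^ n] * A n * (Theta z * z ^ n)) M).
    apply/funext => M; rewrite -partial_sum_telescope -partial_sumB.
    apply: eq_bigr => k _; rewrite /F rec (expfzDr (k%:Z - M%:Z) 1 z0) expr1z; ring.
  by apply: cvgB; [exact: pc|apply: cvgM; [exact: cvg_cst|exact: mc]].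
(* The lower boundary term is eventually 0; the upper one tends to 0 as a term of a convergent
   sum. *)
have : (fun M => F (- M%:Z) - F M.+1%:Z) @ \oo --> (0 : C).
  rewrite -(subrr 0); apply: cvgB; last exact: cvg_partial_sum_last F0 pc.
  apply: cvg_near_cst; near=> M; apply: F0.
  have : (N < M)%N by near: M; exact: nbhs_infty_gt.
  by lia.
by move=> h1 h2; exact: (cvg_unique _ h2 h1).
Unshelve. all: by end_near. Qed.

End DifferenceOperators.

(** * Powers of q, roots of unity, and the theta function *)

Section SpecialFunctions.
Variable R : realType.
Local Notation C := R[i].
Implicit Types (tau x y : C).

Lemma cexpD x y : cexp (x + y) = cexp x * cexp y.
Proof.
case: x => a b; case: y => c d; rewrite /cexp /= expRD cosD sinD.
by apply/eqP; rewrite eq_complex /=; apply/andP; split; apply/eqP; ring.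
Qed.

Lemma cexp0 : cexp 0 = 1 :> C.
Proof. by rewrite /cexp /= expR0 cos0 sin0 mul1r. Qed.

Lemma norm_cexp x : `|cexp x| = (expR (complex.Re x))%:C.
Proof.
rewrite /cexp normrM [X in _ * X]normc_def /= cos2Dsin2 sqrtr1 mulr1.
by rewrite normc_def /= expr0n addr0 sqrtr_sqr ger0_norm // expR_ge0.
Qed.

Lemma cexp_neq0 x : cexp x != 0.
Proof. by rewrite -normr_eq0 norm_cexp eq_complex /= gt_eqF ?expR_gt0. Qed.

Lemma qpowD tau (r s : rat) : qpow tau (r + s) = qpow tau r * qpow tau s.
Proof. by rewrite /qpow rmorphD mulrDr cexpD. Qed.

Lemma qpow0 tau : qpow tau 0 = 1.
Proof. by rewrite /qpow rmorph0 mulr0 cexp0. Qed.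

Lemma qpow_neq0 tau r : qpow tau r != 0.
Proof. exact: cexp_neq0. Qed.

Lemma qpowN tau r : qpow tau (- r) = (qpow tau r)^-1.
Proof.
apply: (mulfI (qpow_neq0 tau r)).
by rewrite -qpowD subrr qpow0 mulfV ?qpow_neq0.
Qed.

Lemma qpow_nat tau (n : nat) : qpow tau n%:R = qpow tau 1 ^+ n.
Proof.
elim: n => [|n IH]; first exact: qpow0.
by rewrite -natr1 qpowD IH exprSr.
Qed.

Lemma qpow_int tau (n : int) : qpow tau n%:~R = qpow tau 1 ^ n.
Proof.
case: n => n; first exact: qpow_nat.
by rewrite NegzE mulrNz qpowN -pmulrn qpow_nat.
Qed.

Lemma norm_qpow1_lt1 tau : 0 < complex.Im tau -> `|qpow tau 1| < 1.
Proof.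
case: tau => a b /= b0; rewrite /qpow norm_cexp rmorph1 mulr1 /=.
rewrite (ltcR _ 1) expR_lt1 mul0r add0r oppr_lt0.
by rewrite mulr_gt0 // mulr_gt0 // pi_gt0.
Qed.

Lemma cisD r s : cis R (r + s) = cis R r * cis R s.
Proof. by rewrite /cis rmorphD mulrDr cexpD. Qed.

Lemma cis1 : cis R 1 = 1.
Proof.
rewrite /cis rmorph1 mulr1 /cexp /= expR0 mul1r.
by rewrite mulr_natl cos2pi sin2pi.
Qed.

Lemma cisX r n : cis R r ^+ n = cis R (n%:R * r).
Proof.
elim: n => [|n IH]; first by rewrite mul0r /cis rmorph0 mulr0 cexp0.
by rewrite exprS IH -natr1 mulrDl mul1r addrC cisD.
Qed.

Lemma cis_nat n : cis R n%:R = 1.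
Proof. by rewrite -[n%:R]mulr1 -cisX cis1 expr1n. Qed.

Local Open Scope classical_set_scope.

(* Convergence of the product is not needed: a divergent sequence has limit 0,
   and multiplication by 1 - x <> 0 preserves divergence. *)
Lemma phi_rec tau x : phi tau x = (1 - x) * phi tau (qpow tau 1 * x).
Proof.
rewrite /phi; move: (qpow tau 1) => Q.
pose u x (n : nat) : C := \prod_(k < n) (1 - Q ^+ k * x).
rewrite -/(u x) -/(u (Q * x)).
have uS n : u x (n + 1)%N = (1 - x) * u (Q * x) n.
  rewrite /u addn1 big_ord_recl expr0 mul1r; congr (_ * _).
  by apply: eq_bigr => k _; rewrite exprSr mulrA.
have sep : hausdorff_space C by exact: norm_hausdorff.
have [/cvg_ex[l lP]|ncvg] := pselect (cvgn (u (Q * x))).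
  rewrite (cvg_lim sep lP); apply: (cvg_lim sep).
  rewrite -(cvg_shiftn 1) /=; under eq_fun do rewrite uS.
  by apply: cvgM; [exact: cvg_cst|exact: lP].
rewrite (dvgP ncvg) mulr0.
have [x1|x1] := eqVneq x 1.
  apply: (cvg_lim sep); rewrite -(cvg_shiftn 1) /=.
  rewrite (_ : (fun n => u x (n + 1)%N) = cst 0); first exact: cvg_cst.
  by apply/funext => n; rewrite uS x1 subrr mul0r.
apply: dvgP => /cvg_ex[l]; rewrite -(cvg_shiftn 1) /=.
under eq_fun do rewrite uS.
move=> lP; apply: ncvg; apply/cvg_ex; exists ((1 - x)^-1 * l).
have -> : u (Q * x) = fun n => (1 - x)^-1 * ((1 - x) * u (Q * x) n).
  by apply/funext => n; rewrite mulKf // subr_eq0 eq_sym.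
by apply: cvgM; [exact: cvg_cst|exact: lP].
Qed.

(** After the recursion for [phi] at x and at x^-1, this is 1 - x^-1 = - x^-1 (1 - x). Nothing is
    divided by 1 - x, so x = 1 is covered. *)
Lemma theta_shift tau x : x != 0 ->
  theta tau (qpow tau 1 * x) = - x^-1 * theta tau x.
Proof.
move=> x0; have Q0 := qpow_neq0 tau 1.
rewrite /theta (phi_rec tau x) invfM mulrA mulfV // mul1r.
rewrite (phi_rec tau x^-1).
by move: (phi tau _) (phi tau (_ / x)) => p1 p2; field.
Qed.

(** Numerator and denominator acquire the multipliers - (qz)^-1 and - c (qz)^-1, whose dependence on
    z cancels. For c = q^(-b) s^-1 the remaining constant is q^b s. *)
Lemma theta_ratio_shift tau c z : c != 0 -> z != 0 ->
  theta tau (qpow tau 1 * z)^-1 / theta tau (c * (qpow tau 1 * z)^-1)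
  = c^-1 * (theta tau z^-1 / theta tau (c * z^-1)).
Proof.
move=> c0 z0; have Q0 := qpow_neq0 tau 1.
have := @theta_shift tau; move: (theta tau) (qpow tau 1) Q0 => th Q Q0 thQ.
have shift d : d != 0 -> th (d * (Q * z)^-1) = - (d * (Q * z)^-1) * th (d * z^-1).
  move=> d0; set w := d * (Q * z)^-1.
  have w0 : w != 0 by apply: mulf_neq0 => //; rewrite invr_eq0 mulf_neq0.
  have -> : d * z^-1 = Q * w by rewrite /w; field; rewrite z0 Q0.
  by rewrite thQ // mulrA mulrNN mulfV // mul1r.
(* A factor 1 is inserted so that the numerator is the case d = 1 of [shift]. *)
rewrite -[th (Q * z)^-1](congr1 th (mul1r _)) -[th z^-1](congr1 th (mul1r _)).
rewrite !shift ?oner_eq0 // !mul1r [(_ * th _)^-1]invfM.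
by move: (th z^-1) (th (c * z^-1))^-1 => t1 t2; field; rewrite c0 z0 Q0.
Qed.

End SpecialFunctions.

(** * The contribution of a single coordinate of V *)

Section CoordinateFactor.
Implicit Types (d : rat).

Lemma floorDint d (m : int) : Num.floor (d + m%:~R) = Num.floor d + m.
Proof. by rewrite floorDrz ?intr_int // intrKfloor. Qed.

Lemma fracp_int d (m : int) : fracp (d + m%:~R) = fracp d.
Proof. by rewrite /fracp floorDint rmorphD /=; ring. Qed.

Lemma floorB1 d : Num.floor (d - 1) = Num.floor d - 1.
Proof. exact: (floorDint d (-1)). Qed.

Lemma fracpB1 d : fracp (d - 1) = fracp d.
Proof. exact: (fracp_int d (-1)). Qed.

Lemma h0_neg d : Num.floor d < 0 -> h0 d = [::].
Proof.
move=> d0; rewrite /h0; have -> : Num.max 0 (Num.floor d + 1) = 0 by lia.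
by [].
Qed.

(** The fractional part is the same at d and d - 1, so only the number of weights changes; the last
    one is - {d} - floor d = - d. *)
Lemma h0_pred d : 0 <= Num.floor d -> h0 d = rcons (h0 (d - 1)) (- d).
Proof.
move=> d0; rewrite /h0 floorB1 fracpB1.
have -> : absz (Num.max 0 (Num.floor d + 1)) = (absz (Num.floor d) + 1)%N by lia.
have -> : absz (Num.max 0 (Num.floor d - 1 + 1)) = absz (Num.floor d) by lia.
rewrite iotaD map_cat cats1 add0n; congr rcons.
rewrite /fracp pmulrn gez0_abs //; ring.
Qed.

Lemma h1_nonneg d : -1 <= Num.floor d -> h1 d = [::].
Proof.
move=> d0; rewrite /h1; have -> : Num.max 0 (- Num.floor d - 1) = 0 by lia.
by [].
Qed.

(** The new weight has k = - floor d, and k - {d} = - d. Thus H^0 - H^1 loses the single weight - d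
    in every case. *)
Lemma h1_pred d : Num.floor d < 0 -> h1 (d - 1) = rcons (h1 d) (- d).
Proof.
move=> d0; rewrite /h1 floorB1 fracpB1.
have -> : absz (Num.max 0 (- Num.floor d - 1)) = absz (- Num.floor d - 1) by lia.
have -> : absz (Num.max 0 (- (Num.floor d - 1) - 1))
    = (absz (- Num.floor d - 1) + 1)%N by lia.
rewrite iotaD map_cat cats1; congr rcons.
rewrite /fracp pmulrn PoszD gez0_abs; last by lia.
rewrite !rmorphD /= rmorphN /=; ring.
Qed.

Variables (F : fieldType) (qp : rat -> F) (u : F).
Hypothesis qp0 : qp 0 = 1.

Definition def_factor d : F := \prod_(e <- h0 d | e != 0) (1 - u * qp e).
Definition ob_factor d : F := \prod_(e <- h1 d | e != 0) (1 - u * qp e).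
(** Integrality of [d] expresses that the coordinate is fixed by g(beta); see [fixes_fracp]. *)
Definition sheaf_factor d : F :=
  if (d \is a Num.int) && (d \isn't a Num.nat) then 1 - u else 1.
Definition term_factor d : F := sheaf_factor d * ob_factor d / def_factor d.
Definition level_factor d : F :=
  (-1) ^ Num.floor (- d)
  * ((\prod_(e <- h0 d) (u * qp e)) / (\prod_(e <- h1 d) (u * qp e))).

Lemma int_pred d : (d - 1 \is a Num.int) = (d \is a Num.int).
Proof. by rewrite rpredBr // rpred1. Qed.

(* At d = 0 the omitted weight e = 0 of def_factor is compensated by the Koszul
   factor 1 - u, which appears at d = -1. *)
Lemma term_factor_pred d : def_factor d != 0 ->
  def_factor (d - 1) != 0
  /\ term_factor (d - 1) = term_factor d * (1 - u * qp (- d)).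
Proof.
rewrite /term_factor /def_factor /ob_factor /sheaf_factor int_pred.
have [dneg|dpos] := ltP (Num.floor d) 0.
  have fneg : Num.floor (d - 1) < 0 by rewrite floorB1; lia.
  have d0 : d < 0 by rewrite -floor_lt0.
  rewrite !h0_neg // !big_nil h1_pred // big_rcons /= oppr_eq0 lt_eqF //=.
  rewrite !natrEint oner_eq0 => _; split=> //.
  rewrite [0 <= d]leNgt d0 (_ : (0 <= d - 1) = false); last by apply/negbTE; lra.
  by rewrite !invr1 !andbF /= !mulr1; case: (d \is a Num.int) => /=; ring.
have d0 : 0 <= d by rewrite -floor_ge0.
rewrite h0_pred // big_rcons /= oppr_eq0 !h1_nonneg ?floorB1 //; try lia.
rewrite !big_nil !natrEint int_pred d0 andbT andbN.
have [->|dn0] := eqVneq d 0.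
  move=> _; rewrite h0_neg ?floorB1 ?floor0 // big_nil rpred0.
  have -> : (0 <= 0 - 1 :> rat) = false by [].
  by rewrite oppr0 qp0 !mulr1 invr1 !mulr1 mul1r; split=> //; exact: oner_neq0.
(* A positive integer d has d - 1 >= 0, so no Koszul factor appears at d - 1. *)
have -> : (d \is a Num.int) && ~~ ((d \is a Num.int) && (0 <= d - 1)) = false.
  apply/negbTE; rewrite negb_and negbK; case: intrP => //= -[m dm].
  by move: dn0 d0; rewrite dm; rewrite -[1]/(1%:~R) -rmorphB ler0z intr_eq0 ler0z; lia.
rewrite /= => /[dup] + /mulIf; rewrite mulf_eq0 negb_or => /andP[p0 p1] _.
by split=> //; field; rewrite p0 p1.
Qed.

(** The induction lowers d, the direction in which [def_factor] loses factors and stays nonzero. *)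
Lemma term_factorB d m : def_factor d != 0 ->
  def_factor (d - m%:R) != 0
  /\ term_factor (d - m%:R)
     = term_factor d * \prod_(0 <= k < m) (1 - u * qp (k%:R - d)).
Proof.
elim: m => [|m IH] d0; first by rewrite subr0 big_nil mulr1.
have [IH1 IH2] := IH d0.
have -> : d - m.+1%:R = d - m%:R - 1 by rewrite -natr1; ring.
have [st1 st2] := term_factor_pred IH1; split=> //.
by rewrite st2 IH2 big_nat_recr //= mulrA opprB.
Qed.

Hypotheses (qpD : forall d e, qp (d + e) = qp d * qp e).
Hypotheses (qp_neq0 : forall d, qp d != 0) (u0 : u != 0).

(** The weight u q^(-d) either leaves H^0 or enters H^1, which divides the determinant by it in both
    cases; the sign comes from floor(-d) growing by 1. *)
Lemma level_factor_pred d :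
  level_factor (d - 1) = - (u * qp (- d))^-1 * level_factor d.
Proof.
have uq e : u * qp e != 0 by rewrite mulf_neq0.
rewrite /level_factor (_ : - (d - 1) = - d + 1%:~R); last by rewrite opprB addrC.
rewrite floorDint expfzDr ?oppr_eq0 ?oner_eq0 // expr1z.
move: ((-1) ^ _) (uq (- d)) => sg.
have [dneg|dpos] := ltP (Num.floor d) 0.
  rewrite !(@h0_neg _) ?floorB1 //; last by lia.
  rewrite h1_pred // big_rcons big_nil invfM.
  move: (u * qp (- d)) (\prod_(e <- _) _)^-1 => v p _ /=; ring.
rewrite (h0_pred dpos) big_rcons !h1_nonneg ?floorB1; try lia.
rewrite big_nil; move: (u * qp (- d)) (\prod_(e <- _) _) => v p v0.
by rewrite /= invr1; field.
Qed.

(** With v = u q^(-d), one step multiplies the level by - v^-1 and the rest by 1 - v, and - v^-1 (1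
    - v) = 1 - v^-1. This inversion matches the factors of [op_plus]. *)
Lemma level_term_factorB d m : def_factor d != 0 ->
  level_factor (d - m%:R) * term_factor (d - m%:R)
  = level_factor d * term_factor d
    * \prod_(1 <= k < m.+1) (1 - qp (d - m%:R + k%:R) * u^-1).
Proof.
move=> d0.
(* The operator numbers its factors upwards from d - m, the induction downwards from d. *)
have -> : \prod_(1 <= k < m.+1) (1 - qp (d - m%:R + k%:R) * u^-1)
    = \prod_(0 <= k < m) (1 - qp (d - k%:R) * u^-1).
  rewrite big_add1 /= [RHS]big_nat_rev /= add0n.
  apply: eq_big_nat => k /andP[_ km]; congr (1 - qp _ * _).
  by rewrite natrB //; ring.
elim: m => [|m IH]; first by rewrite subr0 big_nil mulr1.
have -> : d - m.+1%:R = d - m%:R - 1 by rewrite -natr1; ring.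
have [st1 _] := term_factorB m d0; have [_ st2] := term_factor_pred st1.
rewrite st2 level_factor_pred big_nat_recr //= [RHS]mulrA -IH opprB.
have -> : qp (d - m%:R) = (qp (m%:R - d))^-1.
  apply: (mulfI (qp_neq0 (m%:R - d))); rewrite mulfV // -qpD -qp0.
  by congr qp; ring.
move: (level_factor _) (term_factor _) (qp _) (qp_neq0 (m%:R - d)) => l t v v0.
by field; rewrite v0 u0.
Qed.

End CoordinateFactor.

(** * The two operators as polynomials in T_z *)

Section OperatorSymbols.
Variables (R : realType) (X : glsm R) (tau : R[i]) (a : 'rV[R[i]]_(dimV X).+1).
Local Notation C := R[i].
Local Notation I := 'I_(dimV X).+1.
Local Notation q := (qpow tau).

(** The variable stands for T_z, whose value on the summand of degree beta is q^beta s. *)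
Definition symbol_plus : {poly C} :=
  \prod_(i : I | (i < npos X)%N) \prod_(1 <= k < `|wt i|.+1)
    (1 - (q (k%:R - (rch i)%:~R - (wt i)%:~R) * a ord0 i) *: 'X^`|wt i|).

Definition symbol_minus : {poly C} :=
  \prod_(i : I | (npos X <= i)%N) \prod_(0 <= k < `|wt i|)
    (1 - (q (k%:R + (rch i)%:~R) * (a ord0 i)^-1) *: 'X^`|wt i|).

Lemma abs_wt_pos (i : I) : (i < npos X)%N -> wt i = `|wt i|%N.
Proof. by move=> /wt_gt0 wt0; lia. Qed.

Lemma abs_wt_neg (i : I) : (npos X <= i)%N -> - wt i = `|wt i|%N.
Proof. by move=> /wt_lt0 wt0; lia. Qed.

Lemma acts_by_big (J : Type) (l : seq J) (P : pred J)
    (op : J -> (C -> C) -> C -> C) (p : J -> {poly C}) :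
  (forall j, P j -> acts_by (q 1) (op j) (p j)) ->
  acts_by (q 1) (\big[(fun A B => A \o B)/idfun]_(j <- l | P j) op j)
    (\prod_(j <- l | P j) p j).
Proof.
move=> opP; apply: (big_ind2 (acts_by (q 1))); last exact: opP.
  exact: acts_by_id.
by move=> o1 p1 o2 p2; exact: acts_by_comp.
Qed.

Lemma linear_operator_big (J : Type) (l : seq J) (P : pred J)
    (op : J -> (C -> C) -> C -> C) :
  (forall j, P j -> linear_operator (op j)) ->
  linear_operator (\big[(fun A B => A \o B)/idfun]_(j <- l | P j) op j).
Proof.
move=> opP; apply: big_ind => //.
by move=> o1 o2; exact: linear_operator_comp.
Qed.

Lemma acts_by_op_plus :
  0 < complex.Im tau -> acts_by (q 1) (op_plus tau a) symbol_plus.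
Proof.
move=> htau; apply: acts_by_big => i ip; apply: acts_by_big => k _.
rewrite {2}(abs_wt_pos ip); apply: acts_by_one_sub.
- exact: qpow_neq0.
- exact: norm_qpow1_lt1.
- exact: qpow_int.
Qed.

Lemma acts_by_op_minus :
  0 < complex.Im tau -> acts_by (q 1) (op_minus tau a) symbol_minus.
Proof.
move=> htau; apply: acts_by_big => i ip; apply: acts_by_big => k _.
rewrite (abs_wt_neg ip); apply: acts_by_one_sub.
- exact: qpow_neq0.
- exact: norm_qpow1_lt1.
- exact: qpow_int.
Qed.

Lemma linear_op_plus : linear_operator (op_plus tau a).
Proof.
apply: linear_operator_big => i _; apply: linear_operator_big => k _.
exact: linear_operator_one_sub.
Qed.

Lemma linear_op_minus : linear_operator (op_minus tau a).
Proof.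
apply: linear_operator_big => i _; apply: linear_operator_big => k _.
exact: linear_operator_one_sub.
Qed.

Lemma symbol_plus0 : symbol_plus.[0] = 1.
Proof.
rewrite /symbol_plus horner_prod big1 // => i /wt_gt0 wt0.
rewrite horner_prod big1 // => k _.
rewrite hornerD hornerN hornerZ hornerXn hornerC expr0n absz_eq0.
by rewrite gt_eqF // mulr0 subr0.
Qed.

Lemma symbol_minus0 : symbol_minus.[0] = 1.
Proof.
rewrite /symbol_minus horner_prod big1 // => i /wt_lt0 wt0.
rewrite horner_prod big1 // => k _.
rewrite hornerD hornerN hornerZ hornerXn hornerC expr0n absz_eq0.
by rewrite lt_eqF // mulr0 subr0.
Qed.

Lemma qpowX (d : rat) m : q d ^+ m = q (m%:R * d).
Proof.
elim: m => [|m IH]; first by rewrite mul0r qpow0.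
by rewrite exprS IH -natr1 mulrDl mul1r addrC qpowD.
Qed.

Variable s : C.
Hypotheses (s0 : s != 0) (a0 : forall i, a ord0 i != 0).

Lemma U_neq0 (i : I) : U a i s != 0.
Proof. by rewrite /U mulf_neq0 ?invr_eq0 ?expfz_neq0. Qed.

(** Substituting T = q^beta s gives a_i T^(D_i) = q^(D_i beta) U_i^-1, and [rch i] completes the
    exponent to d_i(beta). *)
Lemma symbol_plusE (beta : rat) : symbol_plus.[q beta * s]
  = \prod_(i : I | (i < npos X)%N) \prod_(1 <= k < `|wt i|.+1)
      (1 - q (deg i beta - `|wt i|%:R + k%:R) * (U a i s)^-1).
Proof.
rewrite /symbol_plus horner_prod; apply: eq_bigr => i ip.
rewrite horner_prod; apply: eq_bigr => k _.
rewrite hornerD hornerN hornerZ hornerXn hornerC exprMn qpowX /U /deg.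
have wtE : (wt i)%:~R = `|wt i|%:R :> rat by rewrite {1}(abs_wt_pos ip).
rewrite invfM invrK invr_expz opprK.
rewrite -[s ^ _](congr1 (exprz s) (esym (abs_wt_pos ip))) -exprnP wtE.
have -> : `|wt i|%:R * beta - (rch i)%:~R - `|wt i|%:R + k%:R
  = (k%:R - (rch i)%:~R - `|wt i|%:R) + `|wt i|%:R * beta by ring.
by rewrite [in RHS]qpowD mulrACA.
Qed.

Lemma symbol_minusE (beta : rat) : symbol_minus.[q beta * s]
  = \prod_(i : I | (npos X <= i)%N) \prod_(0 <= k < `|wt i|)
      (1 - U a i s * q (k%:R - deg i beta)).
Proof.
rewrite /symbol_minus horner_prod; apply: eq_bigr => i ip.
rewrite horner_prod; apply: eq_bigr => k _.
rewrite hornerD hornerN hornerZ hornerXn hornerC exprMn qpowX /U /deg.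
have wtE : (wt i)%:~R = - `|wt i|%:R :> rat.
  by rewrite -[LHS]opprK -rmorphN (abs_wt_neg ip).
rewrite (abs_wt_neg ip) -exprnP wtE.
have -> : k%:R - (- `|wt i|%:R * beta - (rch i)%:~R)
  = (k%:R + (rch i)%:~R) + `|wt i|%:R * beta by ring.
rewrite [in RHS]qpowD; congr (1 - _); move: (q _) (q _) (_ ^-1) (s ^+ _) => x y v w.
ring.
Qed.

End OperatorSymbols.

(** * The coefficients of the I-function and their recurrence *)

Section Coefficients.
Variables (R : realType) (X : glsm R) (tau : R[i]) (a : 'rV[R[i]]_(dimV X).+1).
Local Notation C := R[i].
Local Notation I := 'I_(dimV X).+1.
Local Notation q := (qpow tau).
Variable s : C.
Hypotheses (s0 : s != 0) (a0 : forall i, a ord0 i != 0).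

Definition coefficient (beta : rat) : C :=
  (-1) ^ sigma (Vplus_dual X) beta
  * (structure_sheaf a beta s
     * (level_det tau a (Vplus_dual X) beta s / Lambda_Nvir_dual tau a beta s)).

Lemma I_termE z beta : I_term tau a (Vplus_dual X) z beta s
  = coefficient beta
    * (theta tau z^-1 / theta tau (q (- fracp beta) * s^-1 * z^-1)
       * z ^ Num.floor beta).
Proof.
rewrite /I_term /coefficient.
move: (structure_sheaf _ _ _ * _) ((-1) ^ _) (theta _ _ / _) (z ^ _) => c sg th zz.
ring.
Qed.

(** Both D_j floor(beta) and [rch j] are integers, so D_j {beta} and d_j(beta) differ by an
    integer. *)
Lemma fixes_fracp (beta : rat) (j : I) :
  fixes (fracp beta) j = (deg j beta \is a Num.int).
Proof.
rewrite /fixes /deg rpredBr ?intr_int // /fracp mulrBr rpredBr //.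
by rewrite rpredM ?intr_int.
Qed.

Lemma Lambda_defE beta :
  Lambda_def tau a beta s = \prod_(j : I) def_factor q (U a j s) (deg j beta).
Proof. by []. Qed.

Lemma structure_sheafE beta : structure_sheaf a beta s
  = \prod_(j : I) sheaf_factor (U a j s) (deg j beta).
Proof.
rewrite /structure_sheaf big_mkcond; apply: eq_bigr => j _.
by rewrite fixes_fracp.
Qed.

Lemma sign_sigma beta : (-1) ^ sigma (Vplus_dual X) beta
  = \prod_(j : I | (j < npos X)%N) (-1) ^ Num.floor (- deg j beta) :> C.
Proof.
rewrite /sigma /Vplus_dual big_map big_filter big_enum_cond /=.
rewrite (big_morph (fun n : int => (-1 : C) ^ n) (id1 := 1) (op1 := *%R)) //.
- apply: eq_bigr => j _; rewrite mul1r; congr (_ ^ Num.floor _).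
  by rewrite /deg rmorphN; ring.
- by move=> x y; rewrite expfzDr // oppr_eq0 oner_eq0.
Qed.

Lemma level_detE beta : level_det tau a (Vplus_dual X) beta s
  = \prod_(j : I | (j < npos X)%N)
      ((\prod_(e <- h0 (deg j beta)) (U a j s * q e))
       / (\prod_(e <- h1 (deg j beta)) (U a j s * q e))).
Proof.
rewrite /level_det /Vplus_dual big_map big_filter big_enum_cond /=.
apply: eq_bigr => j _; rewrite expr1z.
have -> : \prod_(i : I) a ord0 i ^ (- (i == j)%:Z) = (a ord0 j)^-1.
  rewrite (bigD1 j) //= eqxx big1 ?mulr1 // => i /negbTE ->.
  by rewrite oppr0 expr0z.
have -> : (- rch j)%:~R - (- wt j)%:~R * beta = deg j beta.
  by rewrite /deg !rmorphN; ring.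
by [].
Qed.

Lemma coefficientE beta : coefficient beta
  = (\prod_(j : I | (j < npos X)%N) level_factor q (U a j s) (deg j beta))
    * \prod_(j : I) term_factor q (U a j s) (deg j beta).
Proof.
rewrite /coefficient sign_sigma structure_sheafE level_detE.
rewrite /Lambda_Nvir_dual invf_div [RHS]mulrC.
have -> : \prod_(j : I) term_factor q (U a j s) (deg j beta)
    = \prod_(j : I) sheaf_factor (U a j s) (deg j beta)
      * (Lambda_ob tau a beta s / Lambda_def tau a beta s).
  by rewrite Lambda_defE -prodfV -!big_split /=; apply: eq_bigr => j _; rewrite mulrA.
rewrite [in RHS]big_split /=.
move: (\prod_(j | _) _) (\prod_j _) (\prod_(j | _) _) (_ / _) => x y v w; ring.
Qed.

(** The Koszul factor 1 - U_i vanishes: a fixed point on the i-th axis lies outside F_beta. *)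
Lemma coefficient_eq0 (i : I) beta : U a i s = 1 ->
  deg i beta \is a Num.int -> deg i beta \isn't a Num.nat ->
  coefficient beta = 0.
Proof.
move=> Ui di dn; rewrite /coefficient structure_sheafE (bigD1 i) //=.
by rewrite {1}/sheaf_factor di dn Ui subrr !mul0r mulr0.
Qed.

Lemma coefficient_recurrence (i : I) beta :
  (i < npos X)%N -> U a i s = 1 -> deg i beta \is a Num.int ->
  (deg i beta \is a Num.nat -> Lambda_def tau a beta s != 0) ->
  (deg i (beta + 1) \is a Num.nat -> Lambda_def tau a (beta + 1) s != 0) ->
  (symbol_plus tau a).[q (beta + 1) * s] * coefficient (beta + 1)
  = (symbol_minus tau a).[q beta * s] * coefficient beta.
Proof.
move=> ip Ui di gen gen1.
have wtE (j : I) : (j < npos X)%N -> (wt j)%:~R = `|wt j|%:R :> rat.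
  by move=> jp; rewrite {1}(abs_wt_pos jp).
have degD (j : I) : deg j (beta + 1) = deg j beta + (wt j)%:~R.
  by rewrite /deg; ring.
have di1 : deg i (beta + 1) \is a Num.int by rewrite degD rpredD ?intr_int.
have [dn|dn] := boolP (deg i beta \is a Num.nat); last first.
  rewrite [coefficient beta](coefficient_eq0 Ui) // mulr0.
  have [dn1|dn1] := boolP (deg i (beta + 1) \is a Num.nat); last first.
    by rewrite (coefficient_eq0 Ui) // mulr0.
  have /intrP[m dm] := di.
  have m0 : m < 0 by move: dn; rewrite natrEint di /= dm ler0z -ltNge.
  have m1 : (absz m <= absz (wt i))%N.
    have := wt_gt0 ip; move: dn1; rewrite natrEint degD dm -rmorphD ler0z.
    by move=> /andP[_]; lia.
  (* Here m = d_i(beta) < 0 <= m + D_i, so 1 <= |m| <= D_i, and the factor k = |m| of the symbol is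
     1 - q^(m + |m|) = 0. *)
  rewrite symbol_plusE (bigD1 i) //=.
  rewrite (bigD1_seq (absz m)) ?mem_index_iota ?iota_uniq //=; last by lia.
  rewrite Ui invr1 mulr1 degD wtE // dm.
  have -> : m%:~R + `|wt i|%:R - `|wt i|%:R + `|m|%:R = 0 :> rat.
    have mE : m = - (absz m)%:Z by lia.
    have -> : m%:~R = - `|m|%:R :> rat.
      by rewrite {1}mE mulrNz.
    by ring.
  by rewrite qpow0 subrr !mul0r.
have dn1 : deg i (beta + 1) \is a Num.nat by rewrite degD wtE // rpredD ?natr_nat.
have {gen}gen j : def_factor q (U a j s) (deg j beta) != 0.
  by have := gen dn; rewrite Lambda_defE prodf_seq_neq0 => /allP/(_ j (mem_index_enum j)).
have {gen1}gen1 j : def_factor q (U a j s) (deg j (beta + 1)) != 0.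
  by have := gen1 dn1; rewrite Lambda_defE prodf_seq_neq0 => /allP/(_ j (mem_index_enum j)).
have splitE b : coefficient b
  = (\prod_(j : I | (j < npos X)%N)
       (level_factor q (U a j s) (deg j b) * term_factor q (U a j s) (deg j b)))
    * \prod_(j : I | (npos X <= j)%N) term_factor q (U a j s) (deg j b).
  rewrite coefficientE [X in _ * X](bigID (fun j : I => (j < npos X)%N)) /= mulrA.
  rewrite -big_split /=; congr (_ * _).
  by apply: eq_bigl => j; rewrite -leqNgt.
(* Degrees are lowered from beta + 1 to beta for positive weights and from beta to beta + 1 for
   negative ones, hence nonvanishing at both ends. *)
rewrite !splitE symbol_plusE // symbol_minusE // mulrA [RHS]mulrCA -!big_split /=.
congr (_ * _); apply: eq_bigr => j jp.
  have -> : deg j beta = deg j (beta + 1) - `|wt j|%:R.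
    by rewrite degD wtE // addrK.
  rewrite (level_term_factorB (qpow0 tau) (qpowD tau) (qpow_neq0 tau)) //.
    by rewrite mulrC.
  exact: U_neq0.
have -> : deg j (beta + 1) = deg j beta - `|wt j|%:R.
  by rewrite degD -[(wt j)%:~R]opprK -rmorphN (abs_wt_neg jp).
have [_ ->] := @term_factorB _ q (U a j s) (qpow0 tau) _ `|wt j|%N (gen j).
by rewrite mulrC.
Qed.

End Coefficients.

(** * Linear operators and finite sums *)

Section LinearOperators.
Variable R : realType.
Local Notation C := R[i].
Variable op : (C -> C) -> C -> C.
Hypothesis linop : linear_operator op.

Lemma linear_operator0 : op (fun=> 0) = fun=> 0.
Proof.
(* The identity reads op 0 = - op 0 + op 0. *)
have := linop (-1) (fun=> 0) (fun=> 0).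
rewrite mulr0 addr0 => ->; apply/funext => z; ring.
Qed.

Lemma linear_operatorZ (c : C) f z : op (fun z => c * f z) z = c * op f z.
Proof.
have := linop c f (fun=> 0); rewrite linear_operator0.
under eq_fun do rewrite addr0.
by move=> ->; rewrite addr0.
Qed.

Lemma linear_operator_sum (J : Type) (l : seq J) (P : pred J)
    (F : J -> C -> C) z :
  op (fun z => \sum_(j <- l | P j) F j z) z = \sum_(j <- l | P j) op (F j) z.
Proof.
elim: l => [|j l IH].
  by rewrite big_nil; under eq_fun do rewrite big_nil; rewrite linear_operator0.
rewrite big_cons; under eq_fun do rewrite big_cons.
case: (P j) => //; rewrite -IH.
have := linop 1 (F j) (fun z => \sum_(j <- l | P j) F j z).
under eq_fun do rewrite mul1r.
by move=> ->; rewrite mul1r.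
Qed.

End LinearOperators.

(** * The equation for the I-function at one fixed point *)

Section FixedPointContributions.
Variables (R : realType) (X : glsm R) (tau : R[i]).
Variables (a : 'rV[R[i]]_(dimV X).+1) (r : 'I_(dimV X).+1 -> R[i]).
Local Notation C := R[i].
Local Notation I := 'I_(dimV X).+1.
Local Notation q := (qpow tau).
Hypotheses (htau : 0 < complex.Im tau) (ha : forall i, a ord0 i != 0).
Hypotheses (hr : forall i, r i ^ wt i = a ord0 i) (hgen : generic tau a r).

Definition equation_operator (f : C -> C) (z : C) : C :=
  op_plus tau a f z - z * op_minus tau a f z.

Lemma linear_equation_operator : linear_operator equation_operator.
Proof.
move=> c f g; apply/funext => z; rewrite /equation_operator.
rewrite linear_op_plus linear_op_minus; ring.
Qed.

Lemma root_neq0 (i : I) : (i < npos X)%N -> r i != 0.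
Proof.
move=> /wt_gt0 wt0; apply: contraNneq (ha i) => ri.
by rewrite -hr ri exp0rz (gt_eqF wt0) eqxx.
Qed.

Lemma fixed_pt_neq0 (i : I) k : (i < npos X)%N -> fixed_pt r i k != 0.
Proof.
move=> ip; rewrite /fixed_pt mulf_neq0 ?invr_eq0 ?root_neq0 //.
exact: cexp_neq0.
Qed.

Lemma U_fixed_pt (i : I) k : (i < npos X)%N -> U a i (fixed_pt r i k) = 1.
Proof.
move=> ip; have wtE := abs_wt_pos ip; have wt0 := wt_gt0 ip.
rewrite /U -invr_expz; suff -> : fixed_pt r i k ^ wt i = (a ord0 i)^-1.
  by rewrite mulfV ?invr_eq0.
rewrite -hr wtE -!exprnP /fixed_pt exprMn cisX exprVn.
have -> : `|wt i|%:R * (k%:R / (wt i)%:~R) = k%:R :> rat.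
  by rewrite {2}wtE mulrC divfK // pnatr_eq0 absz_eq0 gt_eqF.
by rewrite cis_nat mul1r.
Qed.

Lemma I_K_equation (b : rat) (i : I) (k : nat) z :
  0 <= b < 1 -> (i < npos X)%N -> fixes b i -> (k < `|wt i|)%N ->
  punctured_disc z ->
  equation_operator (fun z => I_K tau a (Vplus_dual X) z b (fixed_pt r i k)) z = 0.
Proof.
move=> b01 ip fixi ki zd; set s := fixed_pt r i k.
have s0 : s != 0 by exact: fixed_pt_neq0.
have Us : U a i s = 1 by exact: U_fixed_pt.
have flb : Num.floor b = 0 by apply: floor_def; rewrite add0r.
have fracb : fracp b = b by rewrite /fracp flb subr0.
have degb (n : int) : deg i (b + n%:~R) \is a Num.int.
  by rewrite -fixes_fracp fracp_int fracb.
pose A (n : int) := coefficient tau a s (b + n%:~R).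
(* All degrees on this component are b + n with n an integer, so they share the fractional part b
   and this quotient. *)
pose Theta (z : C) := theta tau z^-1 / theta tau (q (- b) * s^-1 * z^-1).
have -> : (fun z => I_K tau a (Vplus_dual X) z b s)
    = (fun z => zsum (fun n => A n * (Theta z * z ^ n))).
  apply/funext => w; rewrite /I_K; congr zsum; apply/funext => n.
  rewrite I_termE fracp_int fracb floorDint flb add0r.
  (* Outside [eff] the degree d_i is a negative integer and the coefficient vanishes, so the sum
     extends to all n. *)
  case: ifPn => // /existsPn/(_ i); rewrite ip /= negb_or => /andP[_ dn].
  by rewrite /A (coefficient_eq0 tau Us (degb n) dn) mul0r.
have qb n : q b * s * q 1 ^ n = q (b + n%:~R) * s.
  by rewrite qpowD qpow_int mulrAC.
apply: (@qdifference_equation _ (q 1) (qpow_neq0 tau 1) (norm_qpow1_lt1 htau)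
  _ _ (symbol_plus tau a) (symbol_minus tau a) Theta (q b * s) A `|rch i|%N).
- exact: acts_by_op_plus.
- exact: acts_by_op_minus.
- exact: symbol_plus0.
- exact: symbol_minus0.
- move=> w w0; rewrite /Theta theta_ratio_shift //; last first.
    by rewrite mulf_neq0 ?qpow_neq0 ?invr_eq0.
  by rewrite qpowN -invfM invrK.
(* For n < - |[rch i]| one has b + n < 0, and D_i >= 1 gives D_i (b + n) <= b + n < n + 1 <=
   [rch i], so d_i is negative. *)
- move=> n nN; apply: (coefficient_eq0 tau Us (degb n)).
  rewrite natrEint degb /= -ltNge /deg subr_lt0.
  have wt1 : 1 <= (wt i)%:~R :> rat by rewrite ler1z; have := wt_gt0 ip; lia.
  have n1 : n%:~R + 1 <= (rch i)%:~R :> rat.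
    by rewrite -(rmorphD _ n 1) ler_int; lia.
  have n0 : n%:~R + 1 <= 0 :> rat.
    by rewrite -(rmorphD _ n 1) lerz0; lia.
  have /andP[b0 b1] := b01.
  have : (wt i)%:~R * (b + n%:~R) <= 1 * (b + n%:~R).
    by apply: ler_wnM2r => //; lra.
  by lra.
- move=> n; rewrite !qb /A.
  have -> : b + (n + 1)%:~R = b + n%:~R + 1 by rewrite rmorphD /=; ring.
  (* The second alternative in [eff] makes genericity available at every such degree. *)
  have gen beta : deg i beta \is a Num.nat -> Lambda_def tau a beta s != 0.
    move=> dn; apply: hgen => //; apply/existsP; exists i.
    by rewrite ip dn orbT.
  by apply: (coefficient_recurrence s0 ha ip Us) => //; exact: gen.
- exact: zd.
Qed.

Lemma box_itv (m : 'I_(lcm_wt X)) : 0 <= box m < 1.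
Proof.
have l0 : (0 < lcm_wt X)%N by exact: leq_ltn_trans (ltn_ord m).
by rewrite /box divr_ge0 //= ltr_pdivrMr ?ltr0n // mul1r ltr_nat.
Qed.

End FixedPointContributions.

(** * Summation of the fixed-point contributions *)

Theorem mainTheorem4 (R : realType) (X : glsm R)
  (tau : R[i]) (htau : 0 < complex.Im tau)
  (a : 'rV[R[i]]_(dimV X).+1) (r : 'I_(dimV X).+1 -> R[i])
  (ha : forall i, a ord0 i != 0)
  (hr : forall i, r i ^ wt i = a ord0 i)
  (hgen : generic tau a r)
  (E : 'rV[R[i]]_(dimV X).+1 * R[i] -> R[i]) (hE : section_Ell tau E)
  (z : R[i]) (hz0 : z != 0) (hz1 : `|z| < 1) :
  op_plus tau a (Z_K tau a r E) z - z * op_minus tau a (Z_K tau a r E) z = 0.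
Proof.
have lin := linear_equation_operator tau a.
rewrite -/(equation_operator tau a (Z_K tau a r E) z).
rewrite /Z_K /chi linear_operator_sum // big1 // => m _.
rewrite linear_operator_sum // big1 // => i /andP[ip fixi].
rewrite linear_operator_sum // big1 // => k _.
set s := fixed_pt r i k; set den := \prod_(j | _) _.
(* The Gamma class, the brane and the localization denominator are constant in z and pass through
   the operator. *)
have -> : (fun w => H_K tau a w (box m) s * ch_orb tau a E (box m) s / den)
    = (fun w => (Gamma_K tau a (box m) s * ch_orb tau a E (box m) s / den)
                * I_K tau a (Vplus_dual X) w (box m) s).
  by apply/funext => w; rewrite /H_K -!mulrA mulrC -!mulrA.
rewrite linear_operatorZ // I_K_equation ?mulr0 //; exact: box_itv.
Qed.
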